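(* ($\mathcal{E}$-weak duality) Let $x\in \mathcal{F}$ and $(y, \lambda^L, \lambda^U, \mu)\in\mathcal{F}_{MW}$. (i) If $(f, g_T)$ is $\mathcal{E}$-pseudo-quasi generalized convex on $\Omega$ at $y$, then $$f(x) \nprec^s_{LU} \mathcal{L}(y, \lambda^L, \lambda^U, \mu) -\mathcal{E}\|x-y\|.$$ (ii) If $(f, g_T)$ is strictly $\mathcal{E}$-pseudo-quasi generalized convex on $\Omega$ at $y$, then $$f(x)\not\preceq_{LU} \mathcal{L}(y, \lambda^L, \lambda^U, \mu)-\mathcal{E}\|x-y\|.$$
   Context: **Generalized differentiation.** $\mathbb{R}^n$ carries the usual scalar product and Euclidean norm; $\mathbb{B}_{\mathbb{R}^n}$ is its closed unit ball; $\mathbb{R}^m_+$ is the nonnegative orthant. For $S\subset\mathbb{R}^n$, $x\in S$ and $\varepsilon\ge 0$, let $\widehat N_\varepsilon(x;S)=\{z^*\in\mathbb{R}^n : \limsup_{u\to x,\,u\in S}\frac{\langle z^*,u-x\rangle}{\|u-x\|}\le\varepsilon\}$. The Mordukhovich (limiting) normal cone of $S$ at $\bar x\in\mathrm{cl}\,S$ is $$N(\bar x;S)=\{z^*\in\mathbb{R}^n : \exists\, x^k\to\bar x \text{ with } x^k\in S,\ \varepsilon_k\to0^+,\ z_k^*\to z^*,\ z^*_k\in\widehat N_{\varepsilon_k}(x^k;S)\ \forall k\in\mathbb{N}\}.$$ The Mordukhovich (limiting) subdifferential of $\varphi:\mathbb{R}^n\to\mathbb{R}$ at $\bar x$ is $\partial\varphi(\bar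 x)=\{x^*\in\mathbb{R}^n : (x^*,-1)\in N((\bar x,\varphi(\bar x));\mathrm{epi}\,\varphi)\}$, where $\mathrm{epi}\,\varphi=\{(x,\alpha)\in\mathbb{R}^n\times\mathbb{R}:\alpha\ge\varphi(x)\}$. For a cone $K\subset\mathbb{R}^n$, $K^\circ=\{\nu\in\mathbb{R}^n : \langle z,\nu\rangle\le0\ \forall z\in K\}$ is its polar. **Intervals.** $\mathcal{K}_c$ is the set of closed bounded intervals $[a^L,a^U]$, $a^L\le a^U$, in $\mathbb{R}$. For $A=[a^L,a^U]$, $B=[b^L,b^U]$: $A-B=[a^L-b^U,a^U-b^L]$; $kA=[ka^L,ka^U]$ for $k\ge0$. $A\le_{LU}B$ means $a^L\le b^L$ and $a^U\le b^U$; $A<_{LU}B$ means $A\le_{LU}B$ and $A\ne B$; $A<^s_{LU}B$ means $a^L<b^L$ and $a^U<b^U$. For $m$-tuples $\mathcal{A}=(A_1,\ldots,A_m)$, $\mathcal{B}=(B_1,\ldots,B_m)$ of intervals, operations are componentwise; $\mathcal{A}\preceq_{LU}\mathcal{B}$ means $A_i\le_{LU}B_i$ for all $i$ and $A_k<_{LU}B_k$ for at least one $k$; $\mathcal{A}\prec^s_{LU}\mathcal{B}$ means $A_i<^s_{LU}B_i$ for all $i$; $\not\preceq_{LU}$ and $\nprec^s_{LU}$ are the negations. **Problem.** $I=\{1,\ldots,m\}$. For $i\in I$, $f_i:\mathbb{R}^n\to\mathcal{K}_c$, $f_i(x)=[f_i^L(x),f_i^U(x)]$, where $f_i^L,f_i^U:\mathbb{R}^n\to\mathbb{R}$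 are locally Lipschitz with $f_i^L\le f_i^U$ on $\mathbb{R}^n$. $T$ is an arbitrary (possibly infinite) index set, $g_t:\mathbb{R}^n\to\mathbb{R}$ ($t\in T$) are locally Lipschitz, $g_T=(g_t)_{t\in T}$, and $\Omega\subset\mathbb{R}^n$ is nonempty and closed. The primal problem (SIVP) is to minimize, in the lower-upper (LU) interval order sense, $f=(f_1,\ldots,f_m)$ over the feasible set $\mathcal{F}=\{x\in\Omega : g_t(x)\le0,\ t\in T\}$. Fix reals $0\le\epsilon_i^L\le\epsilon_i^U$ ($i\in I$), $\mathcal{E}_i=[\epsilon_i^L,\epsilon_i^U]$, $\mathcal{E}=(\mathcal{E}_1,\ldots,\mathcal{E}_m)$. $\mathbb{R}_+^{|T|}$ is the set of functions $\mu:T\to\mathbb{R}_+$, $\mu_t=\mu(t)$, that vanish at all but finitely many $t\in T$. **Dual problem (Mond–Weir type).** $\mathcal{L}(y,\lambda^L,\lambda^U,\mu)=f(y)=(f_1(y),\ldots,f_m(y))$ is maximized over the feasible set $\mathcal{F}_{MW}$ consisting of all $(y,\lambda^L,\lambda^U,\mu)\in\Omega\times\mathbb{R}^m_+\times\mathbb{R}^m_+\times\mathbb{R}_+^{|T|}$ such that $$0\in\sum_{i\in I}[\lambda_i^L\partial f_i^L(y)+\lambda_i^U\partial f_i^U(y)]+\sum_{t\in T}\mu_t\partial g_t(y)+\sum_{i\in I}(\lambda_i^L\epsilon_i^U+\lambda_i^U\epsilon_i^L)\mathbb{B}_{\mathbb{R}^n}+N(y;\Omega),$$ $\mu_tg_t(y)\ge0$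 for all $t\in T$, and $\sum_{i\in I}(\lambda_i^L+\lambda_i^U)=1$. **Generalized convexity.** $(f,g_T)$ is $\mathcal{E}$-pseudo-quasi generalized convex on $\Omega$ at $\bar x\in\Omega$ if for any $x\in\Omega$, $z_i^{*L}\in\partial f_i^L(\bar x)$, $z_i^{*U}\in\partial f_i^U(\bar x)$ ($i\in I$), and $x_t^*\in\partial g_t(\bar x)$ ($t\in T$), there exists $\nu\in[N(\bar x;\Omega)]^\circ$ such that (a) $\langle z_i^{*L},\nu\rangle+\epsilon_i^U\|x-\bar x\|\ge0\Rightarrow f_i^L(x)\ge f_i^L(\bar x)-\epsilon_i^U\|x-\bar x\|$ for all $i\in I$; (b) $\langle z_i^{*U},\nu\rangle+\epsilon_i^L\|x-\bar x\|\ge0\Rightarrow f_i^U(x)\ge f_i^U(\bar x)-\epsilon_i^L\|x-\bar x\|$ for all $i\in I$; (c) $g_t(x)\le g_t(\bar x)\Rightarrow\langle x_t^*,\nu\rangle\le0$ for all $t\in T$; (d) $\langle b^*,\nu\rangle\le\|x-\bar x\|$ for all $b^*\in\mathbb{B}_{\mathbb{R}^n}$. It is strictly $\mathcal{E}$-pseudo-quasi generalized convex on $\Omega$ at $\bar x$ if the same holds for any $x\in\Omega\setminus\{\bar x\}$ (and any such $z_i^{*L},z_i^{*U},x_t^*$), with the concluding inequalities $\ge$ in (a) and (b) (those for $f_i^L(x)$ and $f_i^U(x)$) replaced by strict inequalities $>$. *)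

(* Defs.v *)
From HB Require Import structures.
From mathcomp Require Import all_boot all_order all_algebra.
From mathcomp Require Import all_classical all_reals all_analysis.

Set Implicit Arguments.
Unset Strict Implicit.
Unset Printing Implicit Defensive.

Import Order.TTheory GRing.Theory Num.Theory.
Import numFieldNormedType.Exports.

Local Open Scope classical_set_scope.
Local Open Scope ring_scope.

(* R^n is 'rV[R]_n. The norm that the library puts on row vectors is the max
   norm; it is used here only through the topology it induces. All metric
   quantities use the Euclidean norm [enorm]. *)
Definition dotp {R : realType} {n : nat} (u v : 'rV[R]_n) : R :=
  \sum_(i < n) u ord0 i * v ord0 i.

Definition enorm {R : realType} {n : nat} (u : 'rV[R]_n) : R :=
  Num.sqrt (dotp u u).

Lemma enorm_ge0 {R : realType} {n : nat} (u : 'rV[R]_n) : 0 <= enorm u.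
Proof. exact: sqrtr_ge0. Qed.

Definition eunit_ball {R : realType} {n : nat} : set 'rV[R]_n :=
  [set b | enorm b <= 1].

Definition locally_lipschitz {R : realType} {n : nat} (phi : 'rV[R]_n -> R) :=
  forall x : 'rV[R]_n, exists k : R, exists2 U, nbhs x U &
    forall u v, U u -> U v -> `|phi u - phi v| <= k * enorm (u - v).

Definition polar {R : realType} {n : nat} (K : set 'rV[R]_n) : set 'rV[R]_n :=
  [set nu | forall z, K z -> dotp z nu <= 0].

(* The upper limit is taken over u -> x with u in S and u <> x, and is -oo
   when x is isolated in S. *)
Definition eps_normal {R : realType} {n : nat} (eps : R) (x : 'rV[R]_n)
    (S : set 'rV[R]_n) : set 'rV[R]_n :=
  [set z | (limf_esup (fun u : 'rV[R]_n => (dotp z (u - x) / enorm (u - x))%:E)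
             (within S x^') <= eps%:E)%E].

Definition normal_cone {R : realType} {n : nat} (xbar : 'rV[R]_n)
    (S : set 'rV[R]_n) : set 'rV[R]_n :=
  [set z | exists (x : nat -> 'rV[R]_n) (eps : nat -> R) (zk : nat -> 'rV[R]_n),
    [/\ x @ \oo --> xbar, forall k, S (x k),
        eps @ \oo --> (0 : R) /\ (forall k, 0 < eps k), zk @ \oo --> z &
        forall k, eps_normal (eps k) (x k) S (zk k)]].

(* The point (x, a) of R^n x R, as a vector of R^(n+1). *)
Definition pair_vec {R : realType} {n : nat} (x : 'rV[R]_n) (a : R) :
  'rV[R]_(n + 1) := row_mx x (const_mx a).

Definition epigraph {R : realType} {n : nat} (phi : 'rV[R]_n -> R) :
    set 'rV[R]_(n + 1) :=
  [set w | exists x a, w = pair_vec x a /\ phi x <= a].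

Definition subdiff {R : realType} {n : nat} (phi : 'rV[R]_n -> R)
    (xbar : 'rV[R]_n) : set 'rV[R]_n :=
  [set z | normal_cone (pair_vec xbar (phi xbar)) (epigraph phi)
             (pair_vec z (- 1))].

Record Kc (R : realType) := Interval {
  lo : R;
  up : R;
  lo_le_up : lo <= up }.

Section IntervalOperations.
Context {R : realType}.
Implicit Types A B : Kc R.

Fact Kc_sub_subproof A B : lo A - up B <= up A - lo B.
Proof. exact: lerB (lo_le_up A) (lo_le_up B). Qed.

Definition Kc_sub A B : Kc R := Interval (Kc_sub_subproof A B).

Fact Kc_scale_subproof (k : {nonneg R}) A : k%:num * lo A <= k%:num * up A.
Proof. exact: ler_wpM2l (lo_le_up A). Qed.

Definition Kc_scale (k : {nonneg R}) A : Kc R :=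
  Interval (Kc_scale_subproof k A).

Definition le_LU A B := lo A <= lo B /\ up A <= up B.
Definition lt_LU A B := le_LU A B /\ A <> B.
Definition slt_LU A B := lo A < lo B /\ up A < up B.

End IntervalOperations.

Section IntervalTuples.
Context {R : realType} {m : nat}.
Implicit Types A B : 'I_m -> Kc R.

Definition tuple_sub A B : 'I_m -> Kc R := fun i => Kc_sub (A i) (B i).

Definition tuple_scale (k : {nonneg R}) A : 'I_m -> Kc R :=
  fun i => Kc_scale k (A i).

Definition prec_LU A B :=
  (forall i, le_LU (A i) (B i)) /\ (exists k, lt_LU (A k) (B k)).

Definition sprec_LU A B := forall i, slt_LU (A i) (B i).

End IntervalTuples.

Section Minkowski.
Context {R : realType} {V : lmodType R}.

Definition set_add (A B : set V) : set V := [set a + b | a in A & b in B].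

Definition set_scale (k : R) (A : set V) : set V := [set k *: a | a in A].

(* Minkowski sum of the sets A j, j in D; meaningful for finite D only, and
   equal to {0} for D empty. *)
Definition set_sum {J : choiceType} (D : set J) (A : J -> set V) : set V :=
  [set \sum_(j \in D) z j | z in [set z : J -> V | forall j, D j -> A j (z j)]].

End Minkowski.

(* R_+^{|T|}; [mu_supp] is its support, over which the sums indexed by T are
   taken. {classic T} is T with a choiceType structure. *)
Definition mu_supp {R : realType} {T : Type} (mu : T -> R) : set {classic T} :=
  [set t : T | mu t != 0].

Definition fin_multiplier {R : realType} {T : Type} (mu : T -> R) :=
  (forall t, 0 <= mu t) /\ finite_set (mu_supp mu).

Section Problem.
Context {R : realType} {n m : nat} {T : Type}.
Variables (f : 'I_m -> 'rV[R]_n -> Kc R) (g : T -> 'rV[R]_n -> R).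
Variables (Omega : set 'rV[R]_n) (E : 'I_m -> Kc R).

Definition fL i x := lo (f i x).
Definition fU i x := up (f i x).

Definition f_tuple (x : 'rV[R]_n) : 'I_m -> Kc R := fun i => f i x.

Definition SIVP_feasible : set 'rV[R]_n :=
  [set x | Omega x /\ forall t, g t x <= 0].

Definition MW_sum (y : 'rV[R]_n) (lamL lamU : 'rV[R]_m) (mu : T -> R) :
    set 'rV[R]_n :=
  set_add
    (set_add
      (set_add
        (set_sum [set: 'I_m] (fun i =>
           set_add (set_scale (lamL ord0 i) (subdiff (fL i) y))
                   (set_scale (lamU ord0 i) (subdiff (fU i) y))))
        (set_sum (mu_supp mu) (fun t : T =>
           set_scale (mu t) (subdiff (g t) y))))
      (set_sum [set: 'I_m] (fun i =>
         set_scale (lamL ord0 i * up (E i) + lamU ord0 i * lo (E i))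
           eunit_ball)))
    (normal_cone y Omega).

Definition MW_feasible (y : 'rV[R]_n) (lamL lamU : 'rV[R]_m) (mu : T -> R) :=
  [/\ Omega y /\ fin_multiplier mu,
      forall i, 0 <= lamL ord0 i /\ 0 <= lamU ord0 i,
      MW_sum y lamL lamU mu 0,
      forall t, 0 <= mu t * g t y &
      \sum_(i < m) (lamL ord0 i + lamU ord0 i) = 1].

Definition MW_objective (y : 'rV[R]_n) (lamL lamU : 'rV[R]_m) (mu : T -> R) :
  'I_m -> Kc R := f_tuple y.

Definition pseudo_quasi_gconvex (xbar : 'rV[R]_n) :=
  forall (x : 'rV[R]_n) (zL zU : 'I_m -> 'rV[R]_n) (xs : T -> 'rV[R]_n),
    Omega x ->
    (forall i, subdiff (fL i) xbar (zL i)) ->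
    (forall i, subdiff (fU i) xbar (zU i)) ->
    (forall t, subdiff (g t) xbar (xs t)) ->
  exists nu, [/\ polar (normal_cone xbar Omega) nu,
    forall i, 0 <= dotp (zL i) nu + up (E i) * enorm (x - xbar) ->
      fL i xbar - up (E i) * enorm (x - xbar) <= fL i x,
    forall i, 0 <= dotp (zU i) nu + lo (E i) * enorm (x - xbar) ->
      fU i xbar - lo (E i) * enorm (x - xbar) <= fU i x,
    forall t, g t x <= g t xbar -> dotp (xs t) nu <= 0 &
    forall b, eunit_ball b -> dotp b nu <= enorm (x - xbar)].

Definition strict_pseudo_quasi_gconvex (xbar : 'rV[R]_n) :=
  forall (x : 'rV[R]_n) (zL zU : 'I_m -> 'rV[R]_n) (xs : T -> 'rV[R]_n),
    Omega x -> x <> xbar ->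
    (forall i, subdiff (fL i) xbar (zL i)) ->
    (forall i, subdiff (fU i) xbar (zU i)) ->
    (forall t, subdiff (g t) xbar (xs t)) ->
  exists nu, [/\ polar (normal_cone xbar Omega) nu,
    forall i, 0 <= dotp (zL i) nu + up (E i) * enorm (x - xbar) ->
      fL i xbar - up (E i) * enorm (x - xbar) < fL i x,
    forall i, 0 <= dotp (zU i) nu + lo (E i) * enorm (x - xbar) ->
      fU i xbar - lo (E i) * enorm (x - xbar) < fU i x,
    forall t, g t x <= g t xbar -> dotp (xs t) nu <= 0 &
    forall b, eunit_ball b -> dotp b nu <= enorm (x - xbar)].

End Problem.

(* Main.v *)
Require Import Defs.
From mathcomp Require Import all_boot all_order all_algebra.
From mathcomp Require Import all_classical all_reals all_analysis.
From mathcomp Require Import ring lra.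

Import Order.TTheory GRing.Theory Num.Theory.
Import numFieldNormedType.Exports.

Local Open Scope classical_set_scope.
Local Open Scope ring_scope.

(** Both parts rest on pairing the dual inclusion with the direction nu that
    generalized convexity supplies. The inclusion writes 0 as a sum of multiples
    of subgradients zL i, zU i, xs t, of ball elements and of one normal vector
    to Omega at y. The normal vector has nonpositive product with nu because nu
    lies in the polar of the normal cone. An active constraint, mu t > 0, has
    g t y >= 0 >= g t x, so quasiconvexity makes <xs t, nu> nonpositive. Each
    ball element has product at most |x - y|. What is left
    ([MW_subgradients]) is
    0 <= sum_i lamL i (<zL i, nu> + up (E i) |x - y|)
             + lamU i (<zU i, nu> + lo (E i) |x - y|).
    If f x were smaller than f y - E |x - y| in the relevant order, the
    contrapositives of the pseudoconvexity implications would make every bracket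
    negative, hence also this convex combination ([convex_combination_lt0]).
    Strict convexity says nothing when x = y, but then the two interval tuples
    coincide and neither precedes the other.

    Generalized convexity can be invoked only with a subgradient of g t for
    every t, including the t outside the support of mu, for which the inclusion
    provides none. So one needs that the limiting subdifferential of a locally
    Lipschitz function phi is never empty ([subdiff_nonempty]). Minimizing
    phi(u) + c |u - y|^2 over a small ball around y gives, for c large, an
    interior minimizer u, at which -2c (u - y) is a proximal subgradient. Its
    norm is at most twice the Lipschitz constant, so as c grows the minimizers
    tend to y and the subgradients have a cluster point, which is a limiting
    subgradient at y. *)

(** * Euclidean geometry of row vectors *)

Section Euclidean.
Context {R : realType} {n : nat}.
Implicit Types (u v w x y : 'rV[R]_n) (a : R).

Lemma dotpDl u v w : dotp (u + v) w = dotp u w + dotp v w.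
Proof. by rewrite -big_split; apply: eq_bigr => i _; rewrite mxE mulrDl. Qed.

Lemma dotpZl a u w : dotp (a *: u) w = a * dotp u w.
Proof. by rewrite /dotp mulr_sumr; apply: eq_bigr => i _; rewrite mxE mulrA. Qed.

Lemma dotp0l w : dotp 0 w = 0.
Proof. by rewrite -(scale0r 0) dotpZl mul0r. Qed.

Lemma dotpC u v : dotp u v = dotp v u.
Proof. by apply: eq_bigr => i _; rewrite mulrC. Qed.

Lemma dotp_ge0 u : 0 <= dotp u u.
Proof. by apply: sumr_ge0 => i _; rewrite -expr2 sqr_ge0. Qed.

Lemma sqr_enorm u : enorm u ^+ 2 = dotp u u.
Proof. by rewrite sqr_sqrtr // dotp_ge0. Qed.

Lemma enormZ a u : enorm (a *: u) = `|a| * enorm u.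
Proof.
by rewrite /enorm dotpZl dotpC dotpZl mulrA -expr2 sqrtrM ?sqr_ge0 // sqrtr_sqr.
Qed.

Lemma enorm0 : enorm (0 : 'rV[R]_n) = 0.
Proof. by rewrite /enorm dotp0l sqrtr0. Qed.

Lemma coord_le_enorm u i : `|u ord0 i| <= enorm u.
Proof.
rewrite -sqrtr_sqr ler_sqrt ?dotp_ge0 // /dotp (bigD1 i) //= -expr2 lerDl.
by apply: sumr_ge0 => j _; rewrite -expr2 sqr_ge0.
Qed.

Lemma norm_le_enorm u : `|u| <= enorm u.
Proof.
have -> : `|u| = mx_norm u by [].
rewrite mx_normrE; apply/bigmax_leP; split=> [|[i j] _ /=].
  exact: enorm_ge0.
by rewrite ord1 coord_le_enorm.
Qed.

Lemma continuous_dotp_diff y : continuous (fun u => dotp (u - y) (u - y)).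
Proof.
have cj j u : {for u, continuous (fun v : 'rV[R]_n => (v - y) ord0 j)}.
  rewrite (_ : (fun _ => _) = (fun v : 'rV[R]_n => v ord0 j - y ord0 j)).
    apply: (@cvgB _ _ _ (nbhs u) _ (fun v : 'rV[R]_n => v ord0 j) (fun=> y ord0 j)).
      exact: (@coord_continuous R 1 n ord0 j u).
    exact: cvg_cst.
  by apply/funext => v; rewrite !mxE.
rewrite /dotp; apply: continuous_big => [|j _ u]; first exact: add_continuous.
exact: continuousM (cj j u) (cj j u).
Qed.

Lemma near_enorm_lt x y a : enorm (x - y) < a ->
  \forall u \near x, enorm (u - y) < a.
Proof.
move=> xa; have a0 : 0 <= a by rewrite (le_trans (enorm_ge0 _) (ltW xa)).
have : \forall u \near x, dotp (u - y) (u - y) < a ^+ 2.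
  apply: (@cvgr_lt _ _ (nbhs x) _ (fun u => dotp (u - y) (u - y))
    (dotp (x - y) (x - y))); first exact: continuous_dotp_diff.
  by rewrite -sqr_enorm ltr_pXn2r // nnegrE enorm_ge0.
apply: filterS => u; rewrite -sqr_enorm => ua.
by rewrite -(ltr_pXn2r (n := 2)) // nnegrE enorm_ge0.
Qed.

(** The Euclidean balls are a base of neighbourhoods for the topology of the
    max norm: from here on every neighbourhood argument is Euclidean. *)
Lemma nbhs_enormP x (P : set 'rV[R]_n) :
  nbhs x P <-> exists2 r, 0 < r & forall u, enorm (u - x) < r -> P u.
Proof.
split=> [/nbhs_normP[r /= r0 rP]|[r r0 rP]].
  exists r => // u ur; apply: rP => /=.
  by rewrite distrC (le_lt_trans (norm_le_enorm _)).
have : \forall u \near x, enorm (u - x) < r.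
  by apply: near_enorm_lt; rewrite subrr enorm0.
by apply: filterS => u; exact: rP.
Qed.

Lemma compact_enorm_ball y a : compact [set u | enorm (u - y) <= a].
Proof.
pose box := [set v : 'rV[R]_n |
  forall i, `[y ord0 i - a, y ord0 i + a]%classic (v ord0 i)].
have cbox : compact box.
  by apply: (@rV_compact _ _ (fun i => `[y ord0 i - a, y ord0 i + a]%classic))
    => i; exact: segment_compact.
apply: (subclosed_compact _ cbox) => [|u /= ua i]; last first.
  have := le_trans (coord_le_enorm (u - y) i) ua.
  by rewrite !mxE /= in_itv /= ler_norml; lra.
have [a0|a0] := ltP a 0.
  rewrite (_ : [set _ | _] = set0); first exact: closed0.
  by apply/seteqP; split=> // u /=; have := enorm_ge0 (u - y); lra.
rewrite (_ : [set _ | _] =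
  (fun u => dotp (u - y) (u - y)) @^-1` [set r | r <= a ^+ 2]).
  by apply: preimage_closed (@closed_le _ _) => u _; exact: continuous_dotp_diff.
apply/seteqP; split=> u /=; rewrite -sqr_enorm;
  by rewrite ler_pXn2r // nnegrE enorm_ge0.
Qed.

Lemma cvg_enorm (u : nat -> 'rV[R]_n) x (e : nat -> R) :
  e @ \oo --> (0 : R) -> (forall k, enorm (u k - x) <= e k) -> u @ \oo --> x.
Proof.
move=> e0 ue; apply/cvgrPdistC_lt => r r0.
apply: filterS _ (cvgr_lt _ e0 _ r0) => k; apply: le_lt_trans.
exact: le_trans (norm_le_enorm _) (ue k).
Qed.

Lemma dotp_sqrD u v :
  dotp (u + v) (u + v) = dotp u u + 2 * dotp v u + dotp v v.
Proof.
by rewrite dotpDl !(dotpC _ (u + v)) !dotpDl (dotpC u v); ring.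
Qed.

End Euclidean.

(** * Vectors of the product with the line *)

Section Pair.
Context {R : realType} {n : nat}.
Implicit Types (u v x : 'rV[R]_n) (a b : R).

Lemma dotp_pair_vec u v a b :
  dotp (pair_vec u a) (pair_vec v b) = dotp u v + a * b.
Proof.
rewrite /dotp big_split_ord big_ord1; congr (_ + _).
  by apply: eq_bigr => i _; rewrite /pair_vec !row_mxEl.
by rewrite /pair_vec !row_mxEr !mxE.
Qed.

Lemma pair_vecB u v a b :
  pair_vec u a - pair_vec v b = pair_vec (u - v) (a - b).
Proof.
rewrite /pair_vec opp_row_mx add_row_mx; congr row_mx.
by apply/matrixP => i j; rewrite !mxE.
Qed.

Lemma enorm_pair_vec u a : enorm (pair_vec u a) <= enorm u + `|a|.
Proof.
have u0 := enorm_ge0 u.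
rewrite -(ler_pXn2r (n := 2)) // ?nnegrE ?addr_ge0 ?enorm_ge0 //.
rewrite sqr_enorm dotp_pair_vec -sqr_enorm sqrrD -[a * a]expr2.
rewrite real_normK ?num_real // addrAC lerDl.
by rewrite mulrn_wge0 // mulr_ge0.
Qed.

Lemma enorm_le_pair_vec u a : enorm u <= enorm (pair_vec u a).
Proof.
rewrite ler_sqrt ?dotp_ge0 // dotp_pair_vec lerDl -expr2; exact: sqr_ge0.
Qed.

End Pair.

(** * Nonemptiness of the limiting subdifferential *)

Definition proximal_subgradient {R : realType} {n : nat}
    (phi : 'rV[R]_n -> R) (c : R) (x z : 'rV[R]_n) :=
  \forall v \near x, phi x + dotp z (v - x) - c * enorm (v - x) ^+ 2 <= phi v.

Section Subgradients.
Context {R : realType} {n : nat}.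
Implicit Types (phi : 'rV[R]_n -> R) (x y z : 'rV[R]_n).

(** The epigraph lies, near its point over x, above a downward paraboloid of
    slope z. The product of (z, -1) with an increment w of the epigraph is thus
    at most c |w|^2, which is at most eps |w| once |w| <= eps / |c|. *)
Lemma eps_normal_epigraph phi c x z eps : 0 < eps ->
  proximal_subgradient phi c x z ->
  eps_normal eps (pair_vec x (phi x)) (epigraph phi) (pair_vec z (- 1)).
Proof.
move=> eps0 /nbhs_enormP[r r0 prox].
pose d := Num.min r (eps / (`|c| + 1)).
have c1 : 0 < `|c| + 1 by rewrite ltr_pwDr.
have d0 : 0 < d by rewrite lt_min r0 divr_gt0.
pose V := [set w | epigraph phi w /\ enorm (w - pair_vec x (phi x)) < d].
apply: (@le_trans _ _ (ereal_sup [set (dotp (pair_vec z (- 1))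
    (w - pair_vec x (phi x)) / enorm (w - pair_vec x (phi x)))%:E | w in V])).
  apply: ereal_inf_lbound; exists V => //.
  by apply/nbhs_enormP; exists d.
(* V contains the base point itself, where the quotient is 0 by convention. *)
apply: ge_ereal_sup => _ [w [[u [a [-> ua]]]] wd <-]; rewrite lee_fin.
move: wd; rewrite !pair_vecB dotp_pair_vec; set N := enorm _ => Nd.
have uN : enorm (u - x) <= N := enorm_le_pair_vec _ _.
have N0 : 0 <= N := enorm_ge0 _.
have [->|Nn0] := eqVneq N 0; first by rewrite invr0 mulr0 ltW.
have Np : 0 < N by rewrite lt_def Nn0.
move: Nd; rewrite lt_min => /andP[Nr Nc].
rewrite ler_pdivrMr //.
have := prox u (le_lt_trans uN Nr); set q := enorm (u - x) ^+ 2 => hu.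
have qN : q <= N * N by rewrite -expr2 ler_pXn2r // nnegrE enorm_ge0.
have cq : c * q <= `|c| * q by rewrite ler_wpM2r ?sqr_ge0 // ler_norm.
have cN : `|c| * q <= `|c| * (N * N) by rewrite ler_wpM2l.
have NE : N * (`|c| + 1) <= eps by rewrite -ler_pdivlMr // ltW.
have : N * (N * (`|c| + 1)) <= N * eps by rewrite ler_wpM2l.
by nra.
Qed.

(** Proximal subgradients are eps-normals for every positive eps, so any
    vanishing sequence of tolerances works in the limit; [harmonic] is one. *)
Lemma limiting_subgradient phi y z (u zk : nat -> 'rV[R]_n) (c e : nat -> R) :
    e @ \oo --> (0 : R) ->
    (forall k, enorm (u k - y) <= e k) ->
    (forall k, `|phi (u k) - phi y| <= e k) ->
    (forall k, enorm (zk k - z) <= e k) ->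
    (forall k, proximal_subgradient phi (c k) (u k) (zk k)) ->
  subdiff phi y z.
Proof.
move=> e0 uy phiy zkz prox.
exists (fun k => pair_vec (u k) (phi (u k))), harmonic,
  (fun k => pair_vec (zk k) (- 1)); split.
- apply: (@cvg_enorm _ _ _ _ (fun k => e k + e k)) => [|k].
    by rewrite -[0]addr0; apply: cvgD.
  by rewrite pair_vecB (le_trans (enorm_pair_vec _ _)) // lerD.
- by move=> k; exists (u k), (phi (u k)).
- by split=> [|k]; [exact: cvg_harmonic | exact: harmonic_gt0].
- apply: (cvg_enorm _ _ _ e0) => k.
  by rewrite pair_vecB subrr (le_trans (enorm_pair_vec _ _)) // normr0 addr0.
- by move=> k; apply: eps_normal_epigraph (prox k); exact: harmonic_gt0.
Qed.

Lemma locally_lipschitz_continuous phi :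
  locally_lipschitz phi -> continuous phi.
Proof.
move=> lip x; have [k [U /nbhs_enormP[r r0 rU] kU]] := lip x.
have Ux : U x by apply: rU; rewrite subrr enorm0.
have k1 : 0 < `|k| + 1 by rewrite ltr_pwDr.
apply/(@cvgrPdistC_lt _ _ _ (nbhs x)) => e e0; apply/nbhs_enormP.
(* `|k| + 1 is a positive Lipschitz constant, whatever the sign of k. *)
exists (Num.min r (e / (`|k| + 1))) => [|u]; first by rewrite lt_min r0 divr_gt0.
rewrite lt_min => /andP[ur]; rewrite ltr_pdivlMr // => ue.
have := kU _ _ (rU _ ur) Ux; have := enorm_ge0 (u - x).
have : k * enorm (u - x) <= `|k| * enorm (u - x).
  by rewrite ler_wpM2r ?enorm_ge0 // ler_norm.
by nra.
Qed.

(** Density of proximal subgradients, with a bound uniform in the distance to y.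
    A minimizer u of phi(u) + c |u - y|^2 satisfies
    c |u - y|^2 <= phi(y) - phi(u) <= L |u - y|, whence c |u - y| <= L: this
    bounds the subgradient -2c (u - y) by 2L and brings u as close to y as
    wanted when c is large. *)
Lemma proximal_subgradient_near phi y : locally_lipschitz phi ->
  exists2 L, 0 <= L & forall d, 0 < d -> exists u z c,
    [/\ enorm (u - y) < d, `|phi u - phi y| < d, enorm z <= L &
        proximal_subgradient phi c u z].
Proof.
move=> lip; have [k [U /nbhs_enormP[r r0 rU] kU]] := lip y.
have Uy : U y by apply: rU; rewrite subrr enorm0.
pose L := `|k| + 1.
have L0 : 0 < L by rewrite ltr_pwDr.
have lipL u : enorm (u - y) < r -> `|phi u - phi y| <= L * enorm (u - y).
  move=> ur; apply: (le_trans (kU _ _ (rU _ ur) Uy)).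
  by rewrite ler_wpM2r ?enorm_ge0 // (le_trans (ler_norm k)) // lerDl.
exists (2 * L) => [|d d0]; first by rewrite mulr_ge0 // ltW.
(* With c = 2L / s the bound c |u - y| <= L gives |u - y| <= s / 2, so the
   minimizer over the ball of radius s is interior. The choice of s keeps this
   ball inside U and makes both s and L s smaller than d. *)
pose s := Num.min (r / 2) (d / (2 * L + 2)).
have s0 : 0 < s by rewrite lt_min !divr_gt0 // addr_gt0 // mulr_gt0.
have sr : s < r by rewrite gt_min ltr_pdivrMr // ltr_pMr // ltr1n.
have sd : s * (2 * L + 2) <= d.
  by rewrite -ler_pdivlMr ?ge_min ?lexx ?orbT // addr_gt0 // mulr_gt0.
pose c := 2 * L / s.
have cs : c * s = 2 * L by rewrite /c divfK // gt_eqF.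
have c0 : 0 < c by rewrite !divr_gt0 ?mulr_gt0.
clearbody c.
pose K := [set u : 'rV[R]_n | enorm (u - y) <= s].
pose psi u := phi u + c * dotp (u - y) (u - y).
have cpsi : continuous psi.
  move=> u; apply: (@cvgD _ _ _ (nbhs u) _ phi
    (fun u => c * dotp (u - y) (u - y))).
    exact: locally_lipschitz_continuous.
  apply: (@cvgM _ _ (nbhs u) _ (fun=> c) (fun u => dotp (u - y) (u - y))).
    exact: cvg_cst.
  exact: continuous_dotp_diff.
have Ky : K y by rewrite /K /= subrr enorm0 ltW.
have [u uK umin] : exists2 u, u \in K & forall v, v \in K -> psi u <= psi v.
  apply: EVT_min_rV; [by exists y | exact: compact_enorm_ball |].
  exact: continuous_subspaceT.
move: uK; rewrite inE /K /= => us.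
have := umin y; rewrite inE => /(_ Ky).
rewrite /psi subrr dotp0l mulr0 addr0 -sqr_enorm => miny.
have D0 := enorm_ge0 (u - y); set D := enorm (u - y) in us miny D0 *.
have := lipL u (le_lt_trans us sr); rewrite -/D => lipu.
have cD : c * D <= L.
  have [->|Dn0] := eqVneq D 0; first by rewrite mulr0 ltW.
  have Dp : 0 < D by rewrite lt_def Dn0.
  rewrite -(ler_pM2r Dp); move: lipu; rewrite ler_norml expr2 in miny *; nra.
have Ds : D < s by rewrite -(ltr_pM2l c0) cs; lra.
exists u, (- (2 * c) *: (u - y)), c; split.
- by rewrite -/D; nra.
- by apply: (le_lt_trans lipu); nra.
- rewrite enormZ -/D normrN ger0_norm; first by lra.
  by rewrite mulr_ge0 // ltW.
- apply: filterS _ (near_enorm_lt _ _ _ Ds) => v vs.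
  have := umin v; rewrite inE => /(_ (ltW vs)).
  (* Completing the square: the difference of the two penalties is
     2c<u - y, v - u> + c|v - u|^2. *)
  rewrite /psi -[v - y](subrKA u) (dotp_sqrD (v - u)) dotpZl sqr_enorm; lra.
Qed.

Lemma subdiff_nonempty phi y : locally_lipschitz phi -> subdiff phi y !=set0.
Proof.
move=> /(proximal_subgradient_near _ y)[L L0 prox].
have /choice[w wP] : forall k, exists w : 'rV[R]_n * 'rV[R]_n * R,
    [/\ enorm (w.1.1 - y) < harmonic k, `|phi w.1.1 - phi y| < harmonic k,
        enorm w.1.2 <= L & proximal_subgradient phi w.2 w.1.1 w.1.2].
  move=> k; have [u [z [c P]]] := prox _ (harmonic_gt0 k).
  by exists (u, z, c).
(* A cluster point of the bounded subgradients; the subsequence j converging to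
   it is extracted with an index j k >= k and an error below 1 / (k + 1). *)
have [|z [_ clz]] := compact_enorm_ball 0 L ((fun k => (w k).1.2) @ \oo).
  by exists 0%N => // k _ /=; rewrite subr0; have [] := wP k.
have /choice[j jP] : forall k, exists j,
    (k <= j)%N /\ enorm ((w j).1.2 - z) < harmonic k.
  move=> k.
  have kz : nbhs z [set v | enorm (v - z) < harmonic k].
    by apply/nbhs_enormP; exists (harmonic k) => //; exact: harmonic_gt0.
  have ki : ((fun i => (w i).1.2) @ \oo) [set (w i).1.2 | i in [set i | (k <= i)%N]].
    by exists k => // i /= ki; exists i.
  by have [_ [[i ki'] <-] iz] := clz _ _ ki kz; exists i.
have mono k : harmonic (j k) <= harmonic k :> R.
  rewrite /harmonic lef_pV2 ?posrE // ler_nat ltnS; by have [] := jP k.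
exists z; apply: (limiting_subgradient phi y z (fun k => (w (j k)).1.1)
  (fun k => (w (j k)).1.2) (fun k => (w (j k)).2) harmonic) => [|k|k|k|k].
- exact: cvg_harmonic.
- by rewrite (le_trans (ltW _) (mono k)) //; have [] := wP (j k).
- by rewrite (le_trans (ltW _) (mono k)) //; have [] := wP (j k).
- by rewrite ltW //; have [] := jP k.
- by have [] := wP (j k).
Qed.

End Subgradients.

(** * Finite sums *)

Section FiniteSums.
Context {R : realType}.

Lemma fsbig_ordT (m : nat) (V : nmodType) (F : 'I_m -> V) :
  \sum_(i \in [set: 'I_m]) F i = \sum_(i < m) F i.
Proof.
have fT : finite_set [set: 'I_m] := finite_finset.
rewrite fsbig_finite //=; apply: perm_big; apply: uniq_perm => /=.
- exact: finmap.fset_uniq.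
- exact: index_enum_uniq.
- by move=> i; rewrite mem_index_enum in_fset_set // mem_set.
Qed.

Lemma dotp_fsuml {n : nat} (J : choiceType) (D : set J) (z : J -> 'rV[R]_n)
    (w : 'rV[R]_n) : finite_set D ->
  dotp (\sum_(j \in D) z j) w = \sum_(j \in D) dotp (z j) w.
Proof.
move=> fD; rewrite !fsbig_finite //.
apply: (big_morph (fun u => dotp u w)) => [u v|]; first exact: dotpDl.
exact: dotp0l.
Qed.

Lemma convex_combination_lt0 (m : nat) (a b p q : 'I_m -> R) :
    (forall i, 0 <= a i /\ 0 <= b i) -> \sum_(i < m) (a i + b i) = 1 ->
    (forall i, p i < 0 /\ q i < 0) ->
  \sum_(i < m) (a i * p i + b i * q i) < 0.
Proof.
move=> ab0 ab1 pq0.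
(* Some pair of weights is nonzero, which makes the inequality strict. *)
have [i abi|abz] := pickP (fun i => a i + b i != 0); last first.
  move/eqP: ab1; rewrite big1 ?(eq_sym 0) ?oner_eq0 // => i _.
  by apply/eqP; rewrite -[_ == _]negbK abz.
rewrite (bigD1 i) //= ltr_wnDr //; last first.
  have [a0 b0] := ab0 i; have [p0 q0] := pq0 i.
  have [ap|ap] := ltP 0 (a i).
    by rewrite ltr_wnDr ?nmulr_llt0 ?pmulr_rlt0 // mulr_ge0_le0 // ltW.
  have a_0 : a i = 0 by apply/eqP; rewrite eq_le ap.
  move: abi; rewrite a_0 add0r mul0r add0r => bi.
  by rewrite pmulr_rlt0 // lt_def bi.
apply: sumr_le0 => j _; have [a0 b0] := ab0 j; have [p0 q0] := pq0 j.
by nra.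
Qed.

End FiniteSums.

Lemma Kc_eq {R : realType} (A B : Kc R) : lo A = lo B -> up A = up B -> A = B.
Proof.
case: A B => [a b ab] [c d cd] /= ac bd; subst c d.
by rewrite (bool_irrelevance ab cd).
Qed.

(** * The dual inclusion and weak duality *)

Section MondWeir.
Context {R : realType} {n m : nat} {T : Type}.
Context (f : 'I_m -> 'rV[R]_n -> Kc R) (g : T -> 'rV[R]_n -> R).
Context (Omega : set 'rV[R]_n) (E : 'I_m -> Kc R).
Context (y : 'rV[R]_n) (lamL lamU : 'rV[R]_m) (mu : T -> R).
Context (g_lip : forall t, locally_lipschitz (g t)).
Context (E_ge0 : forall i, 0 <= lo (E i)).
Context (y_feasible : MW_feasible f g Omega E y lamL lamU mu).

(** The subgradients come from the decomposition of 0 in the dual inclusion,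
    completed off the support of mu by arbitrary ones. They are fixed before nu,
    because in generalized convexity nu depends on them. *)
Lemma MW_subgradients : exists zL zU xs,
  [/\ forall i, subdiff (fL f i) y (zL i),
      forall i, subdiff (fU f i) y (zU i),
      forall t, subdiff (g t) y (xs t) &
      forall nu D, polar (normal_cone y Omega) nu ->
        (forall t, mu t != 0 -> dotp (xs t) nu <= 0) ->
        (forall b, eunit_ball b -> dotp b nu <= D) ->
      0 <= \sum_(i < m) (lamL ord0 i * (dotp (zL i) nu + up (E i) * D) +
                         lamU ord0 i * (dotp (zU i) nu + lo (E i) * D))].
Proof.
have [[_ [mu0 mufin]] lam0 [_ [_ [_ [z zP <-] [_ [x xP <-] <-]]
  [_ [b bP <-] <-]] [w wN sum0]] _ _] := y_feasible.
have /choice[Z ZP] : forall i, exists Z : 'rV[R]_n * 'rV[R]_n,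
    [/\ subdiff (fL f i) y Z.1, subdiff (fU f i) y Z.2 &
        z i = lamL ord0 i *: Z.1 + lamU ord0 i *: Z.2].
  by move=> i; have [_ [ZL ? <-] [_ [ZU ? <-] <-]] := zP i I; exists (ZL, ZU).
have /choice[xs xsP] : forall t : T, exists v,
    subdiff (g t) y v /\ (mu t != 0 -> x t = mu t *: v).
  move=> t; have [mut|mut] := eqVneq (mu t) 0.
    by have [v vP] := subdiff_nonempty (g t) y (g_lip t); exists v.
  by have [v vP <-] := xP t mut; exists v.
have /choice[B BP] : forall i, exists v, eunit_ball v /\
    b i = (lamL ord0 i * up (E i) + lamU ord0 i * lo (E i)) *: v.
  by move=> i; have [v vP <-] := bP i I; exists v.
exists (fun i => (Z i).1), (fun i => (Z i).2), xs; split.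
- by move=> i; have [] := ZP i.
- by move=> i; have [] := ZP i.
- by move=> t; have [] := xsP t.
move=> nu D nuN nux nub.
have fT : finite_set [set: 'I_m] := finite_finset.
have := congr1 (fun v => dotp v nu) sum0.
rewrite dotp0l !dotpDl !dotp_fsuml ?fsbig_ordT // => sum0nu.
have wnu := nuN _ wN.
have xnu : \sum_(t \in mu_supp mu) dotp (x t) nu <= 0.
  apply: fsumr_le0 => t mut; have [_ /(_ mut) ->] := xsP t.
  by rewrite dotpZl mulr_ge0_le0 // nux.
apply: (@le_trans _ _ (\sum_(i < m) dotp (z i) nu + \sum_(i < m) dotp (b i) nu)).
  by lra.
rewrite -big_split; apply: ler_sum => i _ /=.
have [_ _ ->] := ZP i; have [/nub Bnu ->] := BP i.
rewrite dotpDl !dotpZl; have [lL lU] := lam0 i.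
have e0 := E_ge0 i; have e1 := lo_le_up (E i).
have : (lamL ord0 i * up (E i) + lamU ord0 i * lo (E i)) * dotp (B i) nu <=
       (lamL ord0 i * up (E i) + lamU ord0 i * lo (E i)) * D.
  by rewrite ler_wpM2l // addr_ge0 // mulr_ge0 // (le_trans e0).
by lra.
Qed.

Lemma active_constraint_le x t :
  SIVP_feasible g Omega x -> mu t != 0 -> g t x <= g t y.
Proof.
move=> [_ /(_ t) gx] mut; apply: (le_trans gx).
have [[_ [mu0 _]] _ _ /(_ t) + _] := y_feasible.
by rewrite pmulr_rge0 // lt_def mut mu0.
Qed.

End MondWeir.

Theorem theorem4p1 (R : realType) (n m : nat) (T : Type)
    (f : 'I_m -> 'rV[R]_n -> Kc R) (g : T -> 'rV[R]_n -> R)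
    (Omega : set 'rV[R]_n) (E : 'I_m -> Kc R)
    (fL_lip : forall i, locally_lipschitz (fL f i))
    (fU_lip : forall i, locally_lipschitz (fU f i))
    (g_lip : forall t, locally_lipschitz (g t))
    (Omega_nonempty : Omega !=set0) (Omega_closed : closed Omega)
    (E_ge0 : forall i, 0 <= lo (E i))
    (x y : 'rV[R]_n) (lamL lamU : 'rV[R]_m) (mu : T -> R)
    (x_feasible : SIVP_feasible g Omega x)
    (y_feasible : MW_feasible f g Omega E y lamL lamU mu) :
  (pseudo_quasi_gconvex f g Omega E y ->
     ~ sprec_LU (f_tuple f x)
         (tuple_sub (MW_objective f y lamL lamU mu)
            (tuple_scale (NngNum (enorm_ge0 (x - y))) E))) /\
  (strict_pseudo_quasi_gconvex f g Omega E y ->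
     ~ prec_LU (f_tuple f x)
         (tuple_sub (MW_objective f y lamL lamU mu)
            (tuple_scale (NngNum (enorm_ge0 (x - y))) E))).
Proof.
have [zL [zU [xs [zLP zUP xsP key]]]] :=
  MW_subgradients f g Omega E y lamL lamU mu g_lip E_ge0 y_feasible.
have [_ lam0 _ _ lam1] := y_feasible.
have active t := active_constraint_le f g Omega E y lamL lamU mu y_feasible x t
  x_feasible.
have Ox : Omega x by case: x_feasible.
split=> [gconv less|gconv [less [k [_ neq]]]].
- have [nu [nuN convL convU quasi ball]] := gconv x zL zU xs Ox zLP zUP xsP.
  have := key nu (enorm (x - y)) nuN (fun t mut => quasi t (active t mut)) ball.
  apply/negP; rewrite -ltNge; apply: convex_combination_lt0 => // i.
  have [/= lessL lessU] := less i; rewrite !(mulrC (enorm _)) in lessL lessU.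
  split; rewrite ltNge; apply/negP.
    by move=> /convL; rewrite leNgt lessL.
  by move=> /convU; rewrite leNgt lessU.
- have [xy|/eqP xy] := eqVneq x y.
    apply: neq; apply: Kc_eq; rewrite /= xy subrr enorm0 !mul0r !subr0 //.
  have [nu [nuN convL convU quasi ball]] := gconv x zL zU xs Ox xy zLP zUP xsP.
  have := key nu (enorm (x - y)) nuN (fun t mut => quasi t (active t mut)) ball.
  apply/negP; rewrite -ltNge; apply: convex_combination_lt0 => // i.
  have [/= lessL lessU] := less i; rewrite !(mulrC (enorm _)) in lessL lessU.
  split; rewrite ltNge; apply/negP.
    by move=> /convL; rewrite ltNge lessL.
  by move=> /convU; rewrite ltNge lessU.
Qed.
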